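(* Let $d\ge 2$ be an even integer. Every quadratic non-overlapping configuration of dimension $\Delta=2d$ has rank $r\le 6d+36$. Moreover, $r=3\Delta+36=6d+36$ is achieved exactly by the following configurations: $(q_1,q_2,q_3)=\left(\frac r2,\frac r3,\frac r6\right)$; the first two column partitions are $(q_1,q_1)$ and $(q_2,q_2,q_2)$; the third column partition is either $(q_3,q_3,q_3,q_3,q_3,q_3-2,2)$ or $(q_3,q_3,q_3,q_3,q_3,q_3-3,3)$; and the types of the parts are chosen so that the column dimensions are $\Delta_1=-\frac r2$, $\Delta_2=0$, $\Delta_3=\frac{5r}{6}-12$. Such type choices exist for both signs $\varepsilon$; writing the type as an exponent, examples are: - $\varepsilon=-1$: $(q_1^e,q_1^f),\ (q_2^e,q_2^e,q_2^e),\ (q_3^e,q_3^e,q_3^e,q_3^e,q_3^e,(q_3-2)^e,2^e)$; - $\varepsilon=1$: $(q_1^e,q_1^e),\ (q_2^e,q_2^e,q_2^e),\ (q_3^e,q_3^e,q_3^e,q_3^e,q_3^e,(q_3-2)^f,2^e)$; - $\varepsilon=-1$: $(q_1^e,q_1^f),\ (q_2^e,q_2^e,q_2^e),\ (q_3^e,q_3^e,q_3^e,q_3^e,q_3^e,(q_3-3)^f,3^e)$; - $\varepsilon=1$: $(q_1^e,q_1^e),\ (q_2^e,q_2^e,q_2^e),\ (q_3^e,q_3^e,q_3^e,q_3^e,q_3^e,(q_3-3)^e,3^e)$.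
   Context: A quadratic non-overlapping configuration of rank $r$ with sign $\varepsilon\in\{1,-1\}$ consists of: - integers $q_1\ge q_2\ge q_3\ge1$ with $q_1+q_2+q_3=r$ (column widths); - for each $i\in\{1,2,3\}$, a finite collection of positive integers (parts) $\lambda_i^0,\dots,\lambda_i^{s_i}$ with $\sum_j\lambda_i^j=r$ and $\lambda_i^j\le q_i$ for all $j$ (the $i$-th column partition); - an assignment to each part of a type $e$, $f$ or $m$, where the type $m$ parts of each column occur in pairs of equal size. The type $e$ parts of column $i$, listed in decreasing order, are denoted $e_i^0\ge e_i^1\ge\cdots\ge e_i^{s_{i,e}}$ and the type $f$ parts $f_i^0\ge f_i^1\ge\cdots\ge f_i^{s_{i,f}}$. Column quantities: $\beta_i=rq_i-\sum_j(\lambda_i^j)^2$ (box dimension), $l_i=q_i-\sum_j(-1)^je_i^j-\sum_j(-1)^jf_i^j$ (linear correction), $\Delta_i=\beta_i-\varepsilon l_i$ (column dimension). The dimension of the configuration is $\Delta=\Delta_1+\Delta_2+\Delta_3$; equivalently $\Delta=\beta-\varepsilon l$ with $\beta=r^2-\sum_{i,j}(\lambda_i^j)^2$ and $l=r-\sum_{i,j}(-1)^je_i^j-\sum_{i,j}(-1)^jf_i^j$. *)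

(* Defs.v *)
(* Mathematical Components *)
From HB Require Import structures.
From mathcomp Require Import all_boot all_order all_algebra.

Set Implicit Arguments.
Unset Strict Implicit.
Unset Printing Implicit Defensive.

Import GRing.Theory.
Local Open Scope ring_scope.

Inductive ptype := TypeE | TypeF | TypeM.

Definition ptype_code (t : ptype) : option bool :=
  match t with TypeE => Some true | TypeF => Some false | TypeM => None end.

Definition ptype_decode (o : option bool) : ptype :=
  match o with Some true => TypeE | Some false => TypeF | None => TypeM end.

Lemma ptype_codeK : cancel ptype_code ptype_decode.
Proof. by case. Qed.

HB.instance Definition _ := Equality.copy ptype (can_type ptype_codeK).

(* The sequence [parts] represents a finite multiset of typed parts: its order
   is irrelevant, so statements about it are made up to [perm_eq]. *)
Record column := Column { width : nat; parts : seq (nat * ptype) }.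

Definition part_sizes (c : column) : seq nat := [seq p.1 | p <- parts c].

Definition parts_of_type (t : ptype) (c : column) : seq nat :=
  sort geq [seq p.1 | p <- parts c & p.2 == t].

Definition alt_sum (s : seq nat) : int :=
  \sum_(j < size s) (-1) ^+ j * (nth 0%N s j)%:Z.

Definition box_dim (r : nat) (c : column) : int :=
  (r * width c)%:Z - \sum_(x <- part_sizes c) (x ^ 2)%:Z.

Definition lin_corr (c : column) : int :=
  (width c)%:Z - alt_sum (parts_of_type TypeE c)
               - alt_sum (parts_of_type TypeF c).

Definition col_dim (r : nat) (eps : int) (c : column) : int :=
  box_dim r c - eps * lin_corr c.

(* The last clause says that the parts of type m come in pairs of equal size. *)
Definition is_column (r : nat) (c : column) : Prop :=
  [/\ all (fun x => 0 < x <= width c)%N (part_sizes c),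
      sumn (part_sizes c) = r
    & forall x : nat, ~~ odd (count_mem (x, TypeM) (parts c))].

Record config := Config {
  rank : nat;
  sgn : int;
  column1 : column;
  column2 : column;
  column3 : column }.

Definition is_config (c : config) : Prop :=
  [/\ sgn c = 1 \/ sgn c = -1,
      [&& 1 <= width (column3 c), width (column3 c) <= width (column2 c)
        & width (column2 c) <= width (column1 c)]%N,
      (width (column1 c) + width (column2 c) + width (column3 c))%N = rank c
    & [/\ is_column (rank c) (column1 c), is_column (rank c) (column2 c)
        & is_column (rank c) (column3 c)]].

Definition col_dim1 (c : config) : int :=
  col_dim (rank c) (sgn c) (column1 c).
Definition col_dim2 (c : config) : int :=
  col_dim (rank c) (sgn c) (column2 c).
Definition col_dim3 (c : config) : int :=
  col_dim (rank c) (sgn c) (column3 c).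

Definition config_dim (c : config) : int :=
  col_dim1 c + col_dim2 c + col_dim3 c.

Definition third_partition (q k : nat) : seq nat := nseq 5 q ++ [:: q - k; k]%N.

(* Only used when 6 divides [rank c], so that the divisions are exact; the
   third column partition is the one with last part [k]. *)
Definition extremal (k : nat) (c : config) : Prop :=
  let r := rank c in
  let q1 := width (column1 c) in
  let q2 := width (column2 c) in
  let q3 := width (column3 c) in
  [/\ [/\ q1 = (r %/ 2)%N, q2 = (r %/ 3)%N & q3 = (r %/ 6)%N],
      [/\ perm_eq (part_sizes (column1 c)) [:: q1; q1],
          perm_eq (part_sizes (column2 c)) [:: q2; q2; q2]
        & perm_eq (part_sizes (column3 c)) (third_partition q3 k)]
    & [/\ col_dim1 c = - (r %/ 2)%:Z,
          col_dim2 c = 0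
        & col_dim3 c = (5 * r %/ 6)%:Z - 12]].

(* The configuration of rank r and sign eps with columns (q1^e, q1^t1),
   (q2^e, q2^e, q2^e) and (q3^e, q3^e, q3^e, q3^e, q3^e, (q3 - k)^t3, k^e). *)
Definition example (r : nat) (eps : int) (t1 t3 : ptype) (k : nat) : config :=
  let q1 := (r %/ 2)%N in
  let q2 := (r %/ 3)%N in
  let q3 := (r %/ 6)%N in
  Config r eps
    (Column q1 [:: (q1, TypeE); (q1, t1)])
    (Column q2 [:: (q2, TypeE); (q2, TypeE); (q2, TypeE)])
    (Column q3 [:: (q3, TypeE); (q3, TypeE); (q3, TypeE); (q3, TypeE);
                   (q3, TypeE); ((q3 - k)%N, t3); (k, TypeE)]).

(* Main.v *)
(** For a column of width q let N_t be the number of parts larger than t, for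
    t < q. Then sum_t N_t = r, the box dimension is the sum of the differences
    |N_s - N_t| over pairs s < t, and eps times the linear correction is
    sum_t s_t, where the sign s_t vanishes if N_t is odd, is 1 or -1 if N_t is
    even, and depends only on the value N_t. Comparing N with a constant a close
    to r / q, through the total deviations and the numbers of indices below and
    above a, bounds the column dimension D from below: D >= 0 unless r is an even
    multiple of q, in which case D = - q or D >= q (for q >= 6). Moreover, if r is
    within 2 of a multiple of q, then D avoids long intervals above its smallest
    values.

    If Delta >= 4 then 3 Delta + 36 >= 48, so only r >= 48 matters. There, either
    the lower bounds alone exceed (r - 36) / 3, or (q1, q2, q3) is close to
    r (1/2, 1/3, 1/6), r (1/2, 1/4, 1/4), r (1/3, 1/3, 1/3), r (1/2, 1/2, 0), and
    the gaps leave no value of Delta between 4 and (r - 36) / 3; the value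
    (r - 36) / 3 itself is reached only for (1/2, 1/3, 1/6), where Delta_3 equals
    5 q3 - 12 only if two or three of the N_t are 5, as many are 7 and the
    others are 6. *)
Require Import Defs.
From mathcomp Require Import all_boot all_order all_algebra.
From mathcomp Require Import zify.

Set Implicit Arguments.
Unset Strict Implicit.
Unset Printing Implicit Defensive.

Import Order.TTheory GRing.Theory Num.Theory.
Local Open Scope ring_scope.

(** * Levels of a column *)

(** The conjugate partition of the column, indexed from 0. *)
Definition level (c : column) (t : nat) : nat := count (ltn t) (part_sizes c).

Definition typed_level (k : ptype) (c : column) (t : nat) : nat :=
  count (fun p => (p.2 == k) && (t < p.1)%N) (parts c).

Lemma level_split (c : column) (t : nat) :
  level c t = (typed_level TypeE c t + typed_level TypeF c t
               + typed_level TypeM c t)%N.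
Proof.
rewrite /level /part_sizes /typed_level count_map.
elim: (parts c) => //= -[x k] s ->; case: k => /=; lia.
Qed.

Lemma typed_level_nonincr (k : ptype) (c : column) (s t : nat) :
  (s <= t)%N -> (typed_level k c t <= typed_level k c s)%N.
Proof.
move=> st; apply: sub_count => -[x k'] /= /andP[-> /=]; exact: leq_ltn_trans.
Qed.

Lemma level_nonincr (c : column) (s t : nat) :
  (s <= t)%N -> (level c t <= level c s)%N.
Proof. by move=> st; apply: sub_count => x /=; apply: leq_ltn_trans. Qed.

(** A level is the sum of three typed levels, each nonincreasing in [t], so equal sums force equal
    summands. *)
Lemma level_eq_typed (k : ptype) (c : column) (s t : nat) :
  level c s = level c t -> typed_level k c s = typed_level k c t.
Proof.
wlog st : s t / (s <= t)%N => [H | ].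
  by case/orP: (leq_total s t) => st e; [apply: H | apply/esym/H].
rewrite !level_split.
have := typed_level_nonincr TypeE c st; have := typed_level_nonincr TypeF c st.
have := typed_level_nonincr TypeM c st; case: k; lia.
Qed.

Lemma odd_typed_levelM (r : nat) (c : column) (t : nat) :
  is_column r c -> odd (typed_level TypeM c t) = false.
Proof.
case=> /allP le_w _ evM.
(* Grouping the parts of type m by size leaves a sum of multiplicities, each even. *)
suff -> : typed_level TypeM c t
          = (\sum_(x < (width c).+1 | (t < x)%N) count_mem (x : nat, TypeM) (parts c))%N.
  by elim/big_ind: _ => // [m n em en|i _]; rewrite ?oddD ?em ?en // (negbTE (evM _)).
rewrite /typed_level.
have {le_w}: {in parts c, forall p, (p.1 <= width c)%N}.
  by move=> p pc; have /andP[] := le_w _ (map_f fst pc).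
elim: (parts c) => [|[y k] s IH] le_w /=; first by rewrite big1.
rewrite big_split /= -IH; last by move=> p ps; apply: le_w; rewrite inE ps orbT.
congr addn.
have yw : (y < (width c).+1)%N by apply: (le_w (y, k)); rewrite inE eqxx.
case: (boolP (_ && _)) => /= [/andP[/eqP -> ty] | nty].
  rewrite (bigD1 (Ordinal yw)) //= eqxx big1 // => i /andP[_ /eqP ne].
  case: eqP => // -[yi]; case: ne; exact/val_inj.
rewrite big1 // => i ti; case: eqP => // -[yi kM].
by move: nty; rewrite yi kM eqxx ti.
Qed.

Lemma sum_ltn (q x : nat) : (x <= q)%N -> (\sum_(t < q) (t < x))%N = x.
Proof.
move=> xq; rewrite -big_mkcond /= -(big_ord_widen _ (fun=> 1%N) xq).
by rewrite sum1_card card_ord.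
Qed.

Lemma Posz_sum (I : Type) (s : seq I) (P : pred I) (F : I -> nat) :
  (\sum_(i <- s | P i) F i)%N%:Z = \sum_(i <- s | P i) (F i)%:Z.
Proof. exact: (big_morph Posz PoszD (erefl _)). Qed.

Lemma alt_sum_cons (x : nat) (s : seq nat) : alt_sum (x :: s) = x%:Z - alt_sum s.
Proof.
rewrite /alt_sum big_ord_recl /= expr0 mul1r; congr (_ + _).
by rewrite -sumrN; apply: eq_bigr => i _; rewrite exprS mulN1r mulNr.
Qed.

(** In decreasing order the alternating sum is the total length of the intervals of [t] lying below
    an odd number of terms: a new largest term [x] flips the parity for [t < x], and for [t >= x] no
    term exceeds [t]. *)
Lemma alt_sum_levels (q : nat) (s : seq nat) :
  sorted geq s -> all (leq^~ q) s ->
  alt_sum s = \sum_(t < q) (odd (count (ltn t) s))%:Z.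
Proof.
elim: s => [_ _|x s IH] /=; first by rewrite /alt_sum big_ord0 big1.
move=> xs /andP[xq sq]; rewrite alt_sum_cons IH ?(path_sorted xs) //.
have le_x : all (geq x) s 
  by apply: (order_path_min _ xs) => a b d; rewrite /geq /= => ba ad; exact: leq_trans ad ba.
rewrite -{1}(sum_ltn xq) Posz_sum -sumrB; apply: eq_bigr => t _.
case: (ltnP t x) => tx; first by rewrite add1n oddS; case: odd.
rewrite [count _ _](_ : _ = 0%N) //; apply/eqP; rewrite -leqn0 leqNgt -has_count.
by apply/hasPn => y /(allP le_x) /= yx; rewrite -leqNgt (leq_trans yx).
Qed.

Lemma parts_of_type_levels (k : ptype) (r : nat) (c : column) :
  is_column r c ->
  alt_sum (parts_of_type k c) = \sum_(t < width c) (odd (typed_level k c t))%:Z.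
Proof.
case=> /allP le_w _ _.
rewrite (@alt_sum_levels (width c)) /parts_of_type.
- apply: eq_bigr => t _; congr (Posz (nat_of_bool (odd _))).
  rewrite (permP (permEl (perm_sort _ _))) count_map count_filter.
  by apply: eq_count => p /=; rewrite andbC.
- by apply: sort_sorted => a b; exact: leq_total.
- rewrite all_sort; apply/allP => _ /mapP[p /= pc ->].
  move: pc; rewrite mem_filter => /andP[_ pc].
  by have /andP[] := le_w _ (map_f fst pc).
Qed.

Lemma sum_level (r : nat) (c : column) :
  is_column r c -> (\sum_(t < width c) level c t)%N = r.
Proof.
case=> /allP le_w <- _; rewrite /level.
have {le_w}: {in part_sizes c, forall x, (x <= width c)%N} by move=> x /le_w /andP[].
elim: (part_sizes c) => [|x s IH] le_w /=; first by rewrite big1.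
rewrite big_split /= IH ?sum_ltn ?le_w ?inE ?eqxx // => y ys.
by apply: le_w; rewrite inE ys orbT.
Qed.

(** The smaller of two levels is the level at the larger index, and a part [x] exceeds both indices
    for exactly [x ^ 2] pairs. *)
Lemma sum_sqr_level (r : nat) (c : column) :
  is_column r c ->
  (\sum_(s < width c) \sum_(t < width c) minn (level c s) (level c t))%N
  = (\sum_(x <- part_sizes c) x ^ 2)%N.
Proof.
case=> /allP le_w _ _.
transitivity (\sum_(s < width c) \sum_(t < width c) count (ltn (maxn s t)) (part_sizes c))%N.
  apply: eq_bigr => s _; apply: eq_bigr => t _.
  case: (leqP s t) => st; first by apply/minn_idPr/level_nonincr.
  by apply/minn_idPl/level_nonincr/ltnW.
have {le_w}: {in part_sizes c, forall x, (x <= width c)%N} by move=> x /le_w /andP[].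
elim: (part_sizes c) => [|x s IH] le_w /=.
  by rewrite big_nil big1 // => i _; rewrite big1.
rewrite big_cons -IH; last by move=> y ys; apply: le_w; rewrite inE ys orbT.
under eq_bigr do rewrite big_split /=.
rewrite big_split /=; congr addn.
have xw : (x <= width c)%N by apply: le_w; rewrite inE eqxx.
rewrite -[(x ^ 2)%N]/((x * x)%N) -[RHS](congr2 muln (sum_ltn xw) (sum_ltn xw)) big_distrlr /=.
by apply: eq_bigr => i _; apply: eq_bigr => j _; rewrite gtn_max mulnb.
Qed.

Lemma box_dim_levels (r : nat) (c : column) :
  is_column r c ->
  box_dim r c = (\sum_(s < width c) \sum_(t < width c) (level c s - level c t))%N%:Z.
Proof.
move=> cP; rewrite /box_dim -Posz_sum -(sum_sqr_level cP).
apply/eqP; rewrite subr_eq; apply/eqP; rewrite -PoszD; congr Posz.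
rewrite -big_split -{1}(sum_level cP) big_distrl /=; apply: eq_bigr => s _.
rewrite -big_split /= mulnC -[X in (X * _)%N]card_ord -sum_nat_const.
by apply: eq_bigr => t _; lia.
Qed.


(** * Deviation of the levels from a constant *)

Definition below (a : nat) (c : column) : nat :=
  (\sum_(t < width c) (a - level c t))%N.
Definition above (a : nat) (c : column) : nat :=
  (\sum_(t < width c) (level c t - a))%N.
Definition nbelow (a : nat) (c : column) : nat :=
  (\sum_(t < width c) (level c t < a))%N.
Definition nabove (a : nat) (c : column) : nat :=
  (\sum_(t < width c) (a < level c t))%N.

Lemma below_above (r a : nat) (c : column) :
  is_column r c -> (r + below a c = a * width c + above a c)%N.
Proof.
move=> cP; rewrite -{1}(sum_level cP) mulnC -[X in (X * _)%N]card_ord -sum_nat_const.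
by rewrite -!big_split; apply: eq_bigr => t _ /=; lia.
Qed.

Lemma nbelow_le (a : nat) (c : column) : (nbelow a c <= below a c)%N.
Proof. by apply: leq_sum => t _; lia. Qed.

Lemma nabove_le (a : nat) (c : column) : (nabove a c <= above a c)%N.
Proof. by apply: leq_sum => t _; lia. Qed.

Lemma nbelow_eq0 (a : nat) (c : column) : nbelow a c = 0%N -> below a c = 0%N.
Proof.
move/eqP; rewrite /nbelow sum_nat_eq0 => /forallP n0.
by rewrite /below big1 // => t _; have := n0 t; lia.
Qed.

Lemma nabove_eq0 (a : nat) (c : column) : nabove a c = 0%N -> above a c = 0%N.
Proof.
move/eqP; rewrite /nabove sum_nat_eq0 => /forallP n0.
by rewrite /above big1 // => t _; have := n0 t; lia.
Qed.

Lemma sum_level_eq (a : nat) (c : column) :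
  (\sum_(t < width c) (level c t == a) + nbelow a c + nabove a c)%N = width c.
Proof.
rewrite -[RHS]card_ord -sum1_card -!big_split; apply: eq_bigr => t _ /=.
by case: ltngtP.
Qed.

Lemma nbelow_compl (a : nat) (c : column) :
  (\sum_(t < width c) (a <= level c t))%N = (width c - nbelow a c)%N.
Proof.
suff: (\sum_(t < width c) (a <= level c t) + nbelow a c)%N = width c by lia.
by rewrite -[RHS]card_ord -sum1_card -!big_split; apply: eq_bigr => t _ /=; case: leqP.
Qed.

Lemma nabove_compl (a : nat) (c : column) :
  (\sum_(t < width c) (level c t <= a))%N = (width c - nabove a c)%N.
Proof.
suff: (\sum_(t < width c) (level c t <= a) + nabove a c)%N = width c by lia.
by rewrite -[RHS]card_ord -sum1_card -!big_split; apply: eq_bigr => t _ /=; case: leqP.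
Qed.

(* [W] collects the pairs of levels lying strictly on the same side of [a]. *)
Lemma box_dim_profile (r a : nat) (c : column) :
  is_column r c ->
  exists W : nat,
    box_dim r c = (below a c * (width c - nbelow a c)
                   + above a c * (width c - nabove a c) + W)%N%:Z
    /\ ((below a c <= 2)%N -> (above a c <= 2)%N -> W = 0%N).
Proof.
move=> cP.
exists (\sum_(s < width c) \sum_(t < width c)
  ((((level c s < a) && (level c t < a)) || ((a < level c s) && (a < level c t)))
   * (level c s - level c t)))%N; split.
  rewrite (box_dim_levels cP); congr Posz.
  (* Differences are cut at [a]: a deficit counts once for every index at level at least [a], an
     excess once for every index at level at most [a]. *)
  rewrite -nbelow_compl -nabove_compl [(below _ _ * _)%N]mulnC !big_distrlr /=.
  rewrite -!big_split; apply: eq_bigr => s _; rewrite -!big_split.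
  apply: eq_bigr => t _ /=.
  by case: (ltngtP (level c s) a); case: (ltngtP (level c t) a) => /=; lia.
move=> le_b le_a; apply: big1 => s _; apply: big1 => t _.
case: (eqVneq t s) => [-> | ts]; first by rewrite subnn muln0.
(* Two indices on the same side of [a] each deviate by at least 1; if the total is at most 2, both
   deviate by exactly 1 and their levels agree. *)
have le_st (F : 'I_(width c) -> nat) : (F s + F t <= \sum_i F i)%N.
  by rewrite (bigD1 s) // (bigD1 t) //= leq_add2l leq_addr.
have := le_st (fun t => a - level c t)%N; have := le_st (fun t => level c t - a)%N.
rewrite -/(above a c) -/(below a c).
by case: (ltngtP (level c s) a); case: (ltngtP (level c t) a) => /=; lia.
Qed.

(** * Signs of levels and the linear correction *)

Definition level_sign (eps : int) (c : column) (t : nat) : int :=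
  eps * (1 - (odd (typed_level TypeE c t))%:Z - (odd (typed_level TypeF c t))%:Z).

Lemma lin_corr_levels (r : nat) (eps : int) (c : column) :
  is_column r c -> eps * lin_corr c = \sum_(t < width c) level_sign eps c t.
Proof.
move=> cP; rewrite /lin_corr !(parts_of_type_levels _ cP) -mulr_sumr.
rewrite -{1}[width c]card_ord -sum1_card Posz_sum -!sumrB; congr (_ * _).
Qed.

Lemma level_sign_eq (eps : int) (c : column) (s t : nat) :
  level c s = level c t -> level_sign eps c s = level_sign eps c t.
Proof. by move=> e; rewrite /level_sign !(level_eq_typed _ e). Qed.

(** Type m contributes an even count, so at an odd level exactly one of the e and f counts is odd;
    at an even level both or neither are. *)
Lemma level_sign_odd (r : nat) (eps : int) (c : column) (t : nat) :
  is_column r c -> odd (level c t) -> level_sign eps c t = 0.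
Proof.
move=> cP; rewrite /level_sign level_split !oddD (odd_typed_levelM _ cP).
by do 2!case: odd => //=; rewrite mulr0.
Qed.

Lemma level_sign_even (r : nat) (eps : int) (c : column) (t : nat) :
  is_column r c -> eps = 1 \/ eps = -1 -> ~~ odd (level c t) ->
  level_sign eps c t = 1 \/ level_sign eps c t = -1.
Proof.
move=> cP; rewrite /level_sign level_split !oddD (odd_typed_levelM _ cP).
by case=> ->; do 2!case: odd => //=; lia.
Qed.

Lemma level_sign_le1 (r : nat) (eps : int) (c : column) (t : nat) :
  is_column r c -> eps = 1 \/ eps = -1 ->
  `|level_sign eps c t| <= (~~ odd (level c t))%:Z.
Proof.
move=> cP e; case: (boolP (odd _)) => o; first by rewrite (level_sign_odd _ cP).
by case: (level_sign_even cP e o) => ->.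
Qed.

Lemma lin_corr_odd (r a : nat) (eps : int) (c : column) :
  is_column r c -> eps = 1 \/ eps = -1 -> odd a ->
  `|eps * lin_corr c| <= (nbelow a c + nabove a c)%N%:Z.
Proof.
move=> cP e oa; rewrite (lin_corr_levels _ cP).
rewrite (le_trans (ler_norm_sum _ _ _)) // -big_split /= Posz_sum ler_sum // => t _.
apply: le_trans (level_sign_le1 _ cP e) _.
by case: ltngtP => [//|//|->]; rewrite ?oa //; case: odd.
Qed.

(* The columns [t] with [level c t = a] share their sign; a level farther from
   [a] that is even again is at distance at least 2. *)
Lemma lin_corr_even (r a : nat) (eps : int) (c : column) :
  is_column r c -> eps = 1 \/ eps = -1 -> ~~ odd a ->
  exists s S : int,
    [/\ s = 1 \/ s = -1,
        eps * lin_corr c = s * (width c - nbelow a c - nabove a c)%N%:Z + S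
      & `|S| <= (below a c - nbelow a c + (above a c - nabove a c))%N%:Z].
Proof.
move=> cP e ea; rewrite (lin_corr_levels _ cP).
have [s [s1 sP]] : exists s : int, (s = 1 \/ s = -1) /\
    forall t : 'I_(width c), level c t = a -> level_sign eps c t = s.
  case: (pickP (fun t : 'I_(width c) => level c t == a)) => [t0 /eqP t0a | none].
    exists (level_sign eps c t0); split.
      by apply: (level_sign_even cP e); rewrite t0a.
    by move=> t ta; apply: level_sign_eq; rewrite ta.
  (* Without an index at level [a] any sign will do, since its coefficient is 0. *)
  by exists 1; split; [left | move=> t /eqP; rewrite none].
exists s, (\sum_(t < width c | level c t != a) level_sign eps c t); split=> //.
  rewrite (bigID (fun t : 'I_(width c) => level c t == a)) /=; congr (_ + _).
  have -> : (width c - nbelow a c - nabove a c = \sum_(t < width c) (level c t == a))%N.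
    by have := sum_level_eq a c; lia.
  rewrite Posz_sum mulr_sumr big_mkcond; apply: eq_bigr => t _ /=.
  by case: eqP => [/sP -> | _]; rewrite ?mulr1 ?mulr0.
rewrite (le_trans (ler_norm_sum _ _ _)) //.
have -> : (below a c - nbelow a c + (above a c - nabove a c)
           = \sum_(t < width c) ((a - level c t).-1 + (level c t - a).-1))%N.
  have : (nbelow a c + nabove a c + \sum_(t < width c) ((a - level c t).-1 + (level c t - a).-1)
          = below a c + above a c)%N.
    by rewrite -!big_split; apply: eq_bigr => t _ /=; lia.
  by have := nbelow_le a c; have := nabove_le a c; lia.
rewrite Posz_sum big_mkcond ler_sum //= => t _; case: eqP => //= ne.
apply: le_trans (level_sign_le1 _ cP e) _; rewrite lez_nat.
case: (boolP (odd _)) => //= el.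
lia.
Qed.

(** * Recovering a partition from its levels *)

Lemma eq_sum_leq (I : finType) (F G : I -> nat) (i : I) :
  (forall j, F j <= G j)%N -> (\sum_j G j = \sum_j F j)%N -> G i = F i.
Proof.
move=> FG; rewrite (bigD1 i) // [RHS](bigD1 i) //=.
have := FG i; have : (\sum_(j | j != i) F j <= \sum_(j | j != i) G j)%N by apply: leq_sum.
lia.
Qed.

(** An upward closed set of indices is a final segment, hence fixed by its size. This turns [nbelow]
    and [nabove] into the positions where the levels drop. *)
Lemma sum_upward_closed (q t : nat) (P : pred nat) :
  (forall s u, (s <= u)%N -> P s -> P u) -> (t < q)%N ->
  P t = (q - \sum_(s < q) P s <= t)%N.
Proof.
move=> mono tq; have cmp : (\sum_(s < q) (s < t))%N = t by apply/sum_ltn/ltnW.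
have cmpS : (\sum_(s < q) (s < t.+1))%N = t.+1 by apply: sum_ltn.
have tot : (\sum_(s < q) P s + \sum_(s < q) ~~ P s)%N = q.
  by rewrite -big_split /= -[RHS]card_ord -sum1_card; apply: eq_bigr => s _; case: (P s).
case: (boolP (P t)) => Pt; apply/esym.
  suff : (\sum_(s < q) ~~ P s <= \sum_(s < q) (s < t))%N by lia.
  by apply: leq_sum => s _; case: ltnP => [_ | ts]; rewrite ?leq_b1 // (mono _ _ ts Pt).
apply/negbTE; rewrite -ltnNge.
suff : (\sum_(s < q) (s < t.+1) <= \sum_(s < q) ~~ P s)%N by lia.
by apply: leq_sum => s _; case: ltnP => // st; rewrite (contra (mono _ t st) Pt).
Qed.

Lemma perm_eq_levels (s1 s2 : seq nat) :
  all (ltn 0) s1 -> all (ltn 0) s2 ->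
  (forall t, count (ltn t) s1 = count (ltn t) s2) -> perm_eq s1 s2.
Proof.
move=> p1 p2 e; apply/allP => -[|x] _ /=.
  have n0 s : all (ltn 0) s -> count_mem 0%N s = 0%N.
    by move=> /allP ps; apply/count_memPn/negP => /ps.
  by rewrite !n0.
have cS s : count (ltn x) s = (count_mem x.+1 s + count (ltn x.+1) s)%N.
  by elim: s => //= y s ->; lia.
by have := e x; rewrite !cS e => /eqP; rewrite eqn_add2r.
Qed.

(** The hypotheses say that no level is more than 1 away from [a + 1]: the first [nabove] levels are
    [a + 2], the last [nbelow] are [a], the others [a + 1]. Conjugation gives the list, and the
    filter drops parts 0. *)
Lemma part_sizes_near (r a : nat) (c : column) :
  is_column r c -> below a.+1 c = nbelow a.+1 c -> above a.+1 c = nabove a.+1 c ->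
  perm_eq (part_sizes c)
    [seq x <- nseq a (width c) ++ [:: width c - nbelow a.+1 c; nabove a.+1 c]%N
         | (0 < x)%N].
Proof.
move=> cP eb ea; have /allP le_w := let: And3 h _ _ := cP in h.
apply: perm_eq_levels; first by apply/allP => x /le_w /andP[].
  by apply/allP => x; rewrite mem_filter => /andP[].
move=> t; rewrite count_filter (eq_count (a2 := ltn t)); last first.
  by move=> x /=; case: x => //= x; rewrite andbT.
rewrite count_cat count_nseq /= addn0 -/(level c t).
have nle : (nbelow a.+1 c + nabove a.+1 c <= width c)%N by have := sum_level_eq a.+1 c; lia.
case: (ltnP t (width c)) => tw; last first.
  rewrite [level _ _](_ : _ = 0%N); first by lia.
  apply/eqP; rewrite -leqn0 leqNgt -has_count; apply/hasPn => x /le_w /=; lia.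
have := @eq_sum_leq _ (fun t : 'I_(width c) => (level c t < a.+1)%N : nat) _ (Ordinal tw)
  (fun j => _) eb.
have := @eq_sum_leq _ (fun t : 'I_(width c) => (a.+1 < level c t)%N : nat) _ (Ordinal tw)
  (fun j => _) ea.
move=> /= /(_ ltac:(move=> j; lia)) la /(_ ltac:(move=> j; lia)) lb.
have := @sum_upward_closed _ t (fun t => level c t < a.+1)%N _ tw.
rewrite -/(nbelow a.+1 c) => /(_ ltac:(move=> u v /(level_nonincr c); lia)).
have := @sum_upward_closed _ t (fun t => level c t <= a.+1)%N _ tw.
rewrite nabove_compl => /(_ ltac:(move=> u v /(level_nonincr c); lia)).
lia.
Qed.

(** Reduces a column to a few integers, so that bounds on its dimension become arithmetic. [S] is
    [eps * lin_corr c], and [S'] its share from indices off level [a]. *)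
Lemma col_dim_profile (r a : nat) (eps : int) (c : column) :
  is_column r c -> eps = 1 \/ eps = -1 ->
  exists W S : int,
  [/\ [/\ (r + below a c = a * width c + above a c)%N,
          (nbelow a c <= below a c)%N, (nabove a c <= above a c)%N
        & (nbelow a c + nabove a c <= width c)%N],
      (nbelow a c = 0 -> below a c = 0)%N /\ (nabove a c = 0 -> above a c = 0)%N,
      0 <= W /\ ((below a c <= 2)%N -> (above a c <= 2)%N -> W = 0),
      col_dim r eps c = (below a c)%:Z * ((width c)%:Z - (nbelow a c)%:Z)
        + (above a c)%:Z * ((width c)%:Z - (nabove a c)%:Z) + W - S
    & (odd a -> `|S| <= (nbelow a c)%:Z + (nabove a c)%:Z) /\
      (~~ odd a -> let n0 := (width c)%:Z - (nbelow a c)%:Z - (nabove a c)%:Z in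
        exists S' : int, (S = n0 + S' \/ S = - n0 + S') /\
          `|S'| <= (below a c)%:Z - (nbelow a c)%:Z + ((above a c)%:Z - (nabove a c)%:Z))].
Proof.
move=> cP e; have [W [bW W0]] := box_dim_profile a cP.
have nle : (nbelow a c + nabove a c <= width c)%N by have := sum_level_eq a c; lia.
have bl := nbelow_le a c; have al := nabove_le a c.
exists W%:Z, (eps * lin_corr c); split.
- by split=> //; apply: below_above.
- by split; [apply: nbelow_eq0 | apply: nabove_eq0].
- by split=> // Mle Ple; rewrite W0.
- rewrite /col_dim bW !PoszD !PoszM -!subzn //; lia.
split=> oa; first by rewrite -PoszD; apply: lin_corr_odd cP e oa.
have [s [S [s1 -> Sle]]] := lin_corr_even cP e oa.
by exists S; split; [case: s1 => ->; lia | lia].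
Qed.

(** * Values of the column dimension *)

(** The bound is the value when [b] levels are [a + 1] and the others are [a] with sign 1. *)
Lemma col_dim_even_ge (r a b : nat) (eps : int) (c : column) :
  is_column r c -> eps = 1 \/ eps = -1 -> ~~ odd a ->
  r = (a * width c + b)%N -> (b <= width c)%N ->
  (b%:Z - 1) * ((width c)%:Z - b%:Z) <= col_dim r eps c.
Proof.
move=> cP e ea rE bq.
have [W [S [[bal xM yP xyq] [x0 y0] [W0 _] -> [_ /(_ ea) [S' [Sn S'le]]]]]] :=
  col_dim_profile a cP e.
move: (below a c) (above a c) (nbelow a c) (nabove a c) (width c)
  bal xM yP xyq x0 y0 Sn S'le rE bq => M P x y q bal xM yP xyq x0 y0 Sn S'le rE bq.
have {bal rE} PE : P = (M + b)%N by lia.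
have h1 : M%:Z * y%:Z <= M%:Z * (q%:Z - x%:Z) by rewrite ler_wpM2l; lia.
(* What is left of the difference of both sides after dropping [W], taking [S] maximal and using
   [h1]. *)
suff : 0 <= M%:Z * (q%:Z - 2) + (b%:Z - 2) * (b%:Z - y%:Z) + 2 * x%:Z.
  by rewrite PE in S'le *; nia.
case: b PE bq => [|[|b]] PE bq; [nia | | ].
  have [M0 | M1] : M = 0%N \/ (2 <= q)%N /\ (1 <= y)%N by lia.
    by rewrite M0 in PE xM *; nia.
  by nia.
have : (b.+2%:Z - 2) * (- M%:Z) <= (b.+2%:Z - 2) * (b.+2%:Z - y%:Z).
  by rewrite ler_wpM2l; lia.
by nia.
Qed.

(** The bound is the value when [b] levels are [a + 1] with sign 1 and the others are [a], with sign
    0. *)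
Lemma col_dim_odd_ge (r a b : nat) (eps : int) (c : column) :
  is_column r c -> eps = 1 \/ eps = -1 -> odd a ->
  r = (a * width c + b)%N -> (b <= width c)%N ->
  b%:Z * ((width c)%:Z - b%:Z - 1) <= col_dim r eps c.
Proof.
move=> cP e oa rE bq.
have [W [S [[bal xM yP xyq] [x0 y0] [W0 _] -> [/(_ oa) Sle _]]]] :=
  col_dim_profile a cP e.
move: (below a c) (above a c) (nbelow a c) (nabove a c) (width c)
  bal xM yP xyq x0 y0 Sle rE bq => M P x y q bal xM yP xyq x0 y0 Sle rE bq.
have {bal rE} PE : P = (M + b)%N by lia.
have h1 : M%:Z * y%:Z <= M%:Z * (q%:Z - x%:Z) by rewrite ler_wpM2l; lia.
suff : 0 <= M%:Z * q%:Z - x%:Z + (b%:Z + 1) * (b%:Z - y%:Z).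
  by rewrite PE; nia.
have [|[]] : (b + 2 <= q)%N \/ q = b.+1 \/ q = b by lia.
- have : (b%:Z + 1) * (- M%:Z) <= (b%:Z + 1) * (b%:Z - y%:Z) by rewrite ler_wpM2l; lia.
  by nia.
- move=> qE; have yb : (y <= b)%N by lia.
  by nia.
- by move=> qE; nia.
Qed.

(** Total deficit and excess agree, say [M]. The cases come from [M = 0], [M = 1], [M = 2] and
    [M >= 3], with either sign at level [a]. The value [5 q - 12] is reached with [k = 2] and sign
    -1, or with [k = 3] and sign 1. *)
Lemma col_dim_even_mult (r a : nat) (eps : int) (c : column) :
  is_column r c -> eps = 1 \/ eps = -1 -> ~~ odd a ->
  r = (a * width c)%N -> (6 <= width c)%N ->
  let q := (width c)%:Z in let D := col_dim r eps c in
  [\/ [/\ below a c = 0%N, above a c = 0%N & D = - q \/ D = q],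
      D = q,
      3 * q - 4 <= D <= 3 * q
    | 5 * q - 12 <= D /\ (D = 5 * q - 12 ->
        (exists k, [/\ k = 2%N \/ k = 3%N, below a c = k, above a c = k,
                    nbelow a c = k & nabove a c = k]))].
Proof.
move=> cP e ea rE q6.
have [W [S [[bal xM yP xyq] [x0 y0] [W0 Wz] -> [_ /(_ ea) [S' [Sn S'le]]]]]] :=
  col_dim_profile a cP e.
move: (below a c) (above a c) (nbelow a c) (nabove a c) (width c)
  bal xM yP xyq x0 y0 W0 Wz Sn S'le rE q6 => M P x y q bal xM yP xyq x0 y0 W0 Wz Sn S'le rE q6 /=.
have {bal rE} PE : P = M by lia.
rewrite {}PE in yP y0 Wz S'le *.
case: (ltnP M 3) => M3; last first.
  apply: Or44.
  (* The lower bound is affine in [M] with slope [2 q - 2 - x - y >= 0], so beyond 3 it is least at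
     [M = 4], where it exceeds [5 q - 12]. *)
  have h s : 0 <= (M%:Z - s) * (2 * q%:Z - 2 - x%:Z - y%:Z) \/ M%:Z < s.
    by case: (ltrP M%:Z s) => ?; [right | left; rewrite mulr_ge0; lia].
  have [M4 | ME] : (4 <= M)%N \/ M = 3%N by lia.
    by have [h4 | ] := h 4; [split=> [|eD]; nia | lia].
  rewrite {h}ME in M3 xM yP x0 y0 Wz S'le *; split=> [|eD]; first by lia.
  by exists 3%N; split; lia.
have {W0 Wz} -> : W = 0 by apply: Wz; lia.
case: M M3 xM yP x0 y0 S'le => [|[|[|//]]] _ xM yP x0 y0 S'le.
- by apply: Or41; split=> //; lia.
- have [xE yE] : x = 1%N /\ y = 1%N by lia.
  by rewrite {}xE {}yE in xyq x0 y0 Sn S'le *; case: Sn => ->; [apply: Or42 | apply: Or43]; lia.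
have {}xM : x = 1%N \/ x = 2%N by lia.
have {}yP : y = 1%N \/ y = 2%N by lia.
by case: xM Sn S'le => ->; case: yP => ->; case=> -> S'le;
  [apply: Or43 | apply: Or44 | apply: Or43 | apply: Or44
   | apply: Or43 | apply: Or44 | apply: Or43 | apply: Or44];
  try (split=> [|eD]; [| by exists 2%N; split; lia]); lia.
Qed.

Lemma col_dim_odd_mult (r a : nat) (eps : int) (c : column) :
  is_column r c -> eps = 1 \/ eps = -1 -> odd a ->
  r = (a * width c)%N -> (5 <= width c)%N ->
  let q := (width c)%:Z in let D := col_dim r eps c in
  [\/ [/\ below a c = 0%N, above a c = 0%N & D = 0],
      2 * q - 4 <= D <= 2 * q
    | 3 * q - 11 <= D].
Proof.
move=> cP e oa rE q5.
have [W [S [[bal xM yP xyq] [x0 y0] [W0 Wz] -> [/(_ oa) Sle _]]]] :=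
  col_dim_profile a cP e.
move: (below a c) (above a c) (nbelow a c) (nabove a c) (width c)
  bal xM yP xyq x0 y0 W0 Wz Sle rE q5 => M P x y q bal xM yP xyq x0 y0 W0 Wz Sle rE q5 /=.
have {bal rE} PE : P = M by lia.
rewrite {}PE in yP y0 Wz *.
case: (ltnP M 2) => M2; last first.
  apply: Or33.
  have [M4 | ] : (4 <= M)%N \/ M = 2%N \/ M = 3%N by lia.
    have : 0 <= (M%:Z - 4) * (2 * q%:Z - x%:Z - y%:Z) by rewrite mulr_ge0; lia.
    by nia.
  by case=> ME; rewrite ME in xM yP *; lia.
have {W0 Wz} -> : W = 0 by apply: Wz; lia.
case: M M2 xM yP x0 y0 => [|[|//]] _ xM yP x0 y0.
- by apply: Or31; split=> //; lia.
- have [xE yE] : x = 1%N /\ y = 1%N by lia.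
  by rewrite {}xE {}yE in xyq x0 y0 Sle *; apply: Or32; lia.
Qed.

(** For a single index off by 1 the box dimension is [q - 1], and the common sign of the other
    indices cancels or doubles it. *)
Lemma col_dim_even_near1 (r a : nat) (eps : int) (c : column) :
  is_column r c -> eps = 1 \/ eps = -1 -> ~~ odd a ->
  r.+1 = (a * width c)%N \/ r = (a * width c).+1 -> (2 <= width c)%N ->
  col_dim r eps c = 0 \/ 2 * (width c)%:Z - 2 <= col_dim r eps c.
Proof.
move=> cP e ea rE q2.
have [W [S [[bal xM yP xyq] [x0 y0] [W0 Wz] -> [_ /(_ ea) [S' [Sn S'le]]]]]] :=
  col_dim_profile a cP e.
move: (below a c) (above a c) (nbelow a c) (nabove a c) (width c)
  bal xM yP xyq x0 y0 W0 Wz Sn S'le rE q2 => M P x y q bal xM yP xyq x0 y0 W0 Wz Sn S'le rE q2.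
have {bal rE} PM : P = M.+1 \/ M = P.+1 by lia.
(* Exchanging deficit and excess preserves the formulas. *)
wlog PE : M P x y xM yP xyq x0 y0 Wz Sn S'le {PM} / P = M.+1 => [H|].
  case: PM => PM; first exact: (H M P x y).
  by rewrite [M%:Z * _ + _]addrC; apply: (H P M y x) => //; lia.
rewrite {}PE in yP y0 Wz S'le *.
have [M0 | [M1 | M2]] : M = 0%N \/ M = 1%N \/ (2 <= M)%N by lia.
- rewrite {}M0 in xM yP x0 y0 Wz S'le *.
  have [xE yE] : x = 0%N /\ y = 1%N by lia.
  have -> : W = 0 by apply: Wz.
  rewrite {}xE {}yE in Sn S'le *; lia.
- rewrite {}M1 in xM yP x0 y0 Wz S'le *.
  have xE : x = 1%N by lia.
  by rewrite {}xE in Sn S'le *; lia.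
right.
have : 0 <= (M%:Z - 2) * (2 * q%:Z - 2 - x%:Z - y%:Z) by rewrite mulr_ge0; lia.
by nia.
Qed.

Lemma col_dim_even_near2 (r a : nat) (eps : int) (c : column) :
  is_column r c -> eps = 1 \/ eps = -1 -> ~~ odd a ->
  r.+2 = (a * width c)%N \/ r = (a * width c).+2 -> (2 <= width c)%N ->
  let q := (width c)%:Z in let D := col_dim r eps c in
  q - 2 <= D <= q \/ 3 * q - 6 <= D.
Proof.
move=> cP e ea rE q2.
have [W [S [[bal xM yP xyq] [x0 y0] [W0 Wz] -> [_ /(_ ea) [S' [Sn S'le]]]]]] :=
  col_dim_profile a cP e.
move: (below a c) (above a c) (nbelow a c) (nabove a c) (width c)
  bal xM yP xyq x0 y0 W0 Wz Sn S'le rE q2 => M P x y q bal xM yP xyq x0 y0 W0 Wz Sn S'le rE q2 /=.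
have {bal rE} PM : P = M.+2 \/ M = P.+2 by lia.
wlog PE : M P x y xM yP xyq x0 y0 Wz Sn S'le {PM} / P = M.+2 => [H|].
  case: PM => PM; first exact: (H M P x y).
  by rewrite [M%:Z * _ + _]addrC; apply: (H P M y x) => //; lia.
rewrite {}PE in yP y0 Wz S'le *.
have [M0 | [M1 | M2]] : M = 0%N \/ M = 1%N \/ (2 <= M)%N by lia.
- rewrite {}M0 in xM yP x0 y0 Wz S'le *.
  have -> : W = 0 by apply: Wz.
  have xE : x = 0%N by lia.
  have {yP}[yE | yE] : y = 1%N \/ y = 2%N by lia.
    by rewrite {}xE {}yE in Sn S'le *; lia.
  by rewrite {}xE {}yE in Sn S'le *; lia.
- rewrite {}M1 in xM yP x0 y0 Wz S'le *.
  have xE : x = 1%N by lia.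
  by rewrite {}xE in Sn S'le *; lia.
right.
have : 0 <= (M%:Z - 2) * (2 * q%:Z - 2 - x%:Z - y%:Z) by rewrite mulr_ge0; lia.
by nia.
Qed.

(** If one index is off by 1, only it can have a nonzero sign, so the dimension is within 1 of
    [q - 1]. *)
Lemma col_dim_odd_near1 (r a : nat) (eps : int) (c : column) :
  is_column r c -> eps = 1 \/ eps = -1 -> odd a ->
  r.+1 = (a * width c)%N \/ r = (a * width c).+1 -> (6 <= width c)%N ->
  let q := (width c)%:Z in let D := col_dim r eps c in
  q - 2 <= D <= q \/ 3 * q - 8 <= D.
Proof.
move=> cP e oa rE q6.
have [W [S [[bal xM yP xyq] [x0 y0] [W0 Wz] -> [/(_ oa) Sle _]]]] :=
  col_dim_profile a cP e.
move: (below a c) (above a c) (nbelow a c) (nabove a c) (width c)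
  bal xM yP xyq x0 y0 W0 Wz Sle rE q6 => M P x y q bal xM yP xyq x0 y0 W0 Wz Sle rE q6 /=.
have {bal rE} PM : P = M.+1 \/ M = P.+1 by lia.
wlog PE : M P x y xM yP xyq x0 y0 Wz Sle {PM} / P = M.+1 => [H|].
  case: PM => PM; first exact: (H M P x y).
  by rewrite [M%:Z * _ + _]addrC; apply: (H P M y x) => //; lia.
rewrite {}PE in yP y0 Wz *.
have [M0 | ] : M = 0%N \/ (0 < M)%N by lia.
  rewrite {}M0 in xM yP x0 y0 Wz *.
  have -> : W = 0 by apply: Wz.
  have [xE yE] : x = 0%N /\ y = 1%N by lia.
  by rewrite {}xE {}yE in Sle *; lia.
case: (ltnP M 4) => M4 M1; right.
  have [M1E | [ME | ME]] : M = 1%N \/ M = 2%N \/ M = 3%N by lia.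
  - by rewrite {}M1E in xM yP x0 y0 *; lia.
  - by rewrite {}ME in xM yP x0 y0 *; lia.
  - by rewrite {}ME in xM yP x0 y0 *; lia.
have : 0 <= (M%:Z - 4) * (2 * q%:Z - x%:Z - y%:Z) by rewrite mulr_ge0; lia.
by nia.
Qed.

(** * The bound on the rank *)

Lemma col_dim_width1 (r : nat) (eps : int) (c : column) :
  is_column r c -> eps = 1 \/ eps = -1 -> width c = 1%N -> `|col_dim r eps c| <= 1.
Proof.
move=> cP e q1.
(* The only level of a column of width 1 is [r], so it is compared with [r] itself. *)
have [W [S [[bal xM yP xyq] [x0 y0] [W0 Wz] -> [So Se]]]] := col_dim_profile r cP e.
rewrite q1 in bal xyq Se *.
have [b0 a0] : below r c = 0%N /\ above r c = 0%N by lia.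
rewrite b0 a0 in xM yP Wz Se *; rewrite Wz //.
have [xE yE] : nbelow r c = 0%N /\ nabove r c = 0%N by lia.
rewrite xE yE in So Se *; case: (boolP (odd r)) => [/So|/Se [S' [Sn S'le]]]; lia.
Qed.

(** For quotient [a] and remainder [b] of [r] by the width, the general bounds are nonnegative
    unless [b = 0] and [a] is even. *)
Lemma col_dim_ge (r : nat) (eps : int) (c : column) :
  is_column r c -> eps = 1 \/ eps = -1 -> (0 < width c)%N ->
  0 <= col_dim r eps c
  \/ - (width c)%:Z <= col_dim r eps c /\ exists a, r = (2 * a * width c)%N.
Proof.
move=> cP e q0; have rE := divn_eq r (width c).
have := ltn_pmod r q0; set b := (r %% _)%N in rE *; set a := (r %/ _)%N in rE *.
move=> bq; case: (boolP (odd a)) => pa.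
  have := col_dim_odd_ge cP e pa rE (ltnW bq).
  have : 0 <= b%:Z * ((width c)%:Z - b%:Z - 1) by rewrite mulr_ge0; lia.
  by lia.
have := col_dim_even_ge cP e pa rE (ltnW bq).
case: (posnP b) => b0.
  rewrite b0 in rE *; right; split; first by lia.
  by exists a./2; rewrite mul2n halfK (negbTE pa) subn0 {1}rE addn0.
have : 0 <= (b%:Z - 1) * ((width c)%:Z - b%:Z) by rewrite mulr_ge0; lia.
by left; lia.
Qed.

Lemma col_dim_odd_rank_ge0 (r : nat) (eps : int) (c : column) :
  is_column r c -> eps = 1 \/ eps = -1 -> (0 < width c)%N -> odd r ->
  0 <= col_dim r eps c.
Proof.
move=> cP e q0 or; case: (col_dim_ge cP e q0) => // -[_ [a rE]].
by move: or; rewrite rE -mulnA oddM.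
Qed.

(** The difference [q1 - q2 - q3] is odd. If it is at least 3, the first column suffices. If it is
    1, then [r = 2 q1 - 1], the gap above 0 leaves [D1 = 0], and the position of [q2] relative to
    [q3] and [2 q3] decides. *)
Lemma odd_rank_bound_gt (c : config) :
  is_config c -> (48 <= rank c)%N -> 4 <= config_dim c -> odd (rank c) ->
  (rank c < 2 * width (column1 c))%N ->
  (rank c)%:Z < 3 * config_dim c + 36.
Proof.
case: c => r eps c1 c2 c3; case=> /= e /and3P[q30 q32 q21] rE [C1 C2 C3].
rewrite /config_dim /col_dim1 /col_dim2 /col_dim3 /= => r48 Dpos oddr q1r.
have D1 := col_dim_odd_rank_ge0 C1 e ltac:(lia) oddr.
have D2 := col_dim_odd_rank_ge0 C2 e ltac:(lia) oddr.
have D3 := col_dim_odd_rank_ge0 C3 e ltac:(lia) oddr.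
have D1' := @col_dim_odd_ge r 1 (width c2 + width c3) _ _ C1 e isT ltac:(lia) ltac:(lia).
case: (ltnP (width c2 + width c3).+1 (width c1)) => q1b.
  have hb : (width c2 + width c3 + 3 <= width c1)%N by lia.
  move: (col_dim _ _ _) (col_dim _ _ _) (col_dim _ _ _) D1 D2 D3 D1' => d1 d2 d3 *.
  have : 0 <= ((width c2)%:Z + (width c3)%:Z - 2)
              * ((width c1)%:Z - (width c2)%:Z - (width c3)%:Z - 3) by rewrite mulr_ge0; lia.
  by nia.
have [{}D1' | {}D1'] := @col_dim_even_near1 r 2 _ _ C1 e isT ltac:(left; lia) ltac:(lia);
  last by lia.
have [q23 | q23] : (width c2 = width c3 \/ width c3 < width c2)%N by lia.
  have := @col_dim_even_near1 r 4 _ _ C2 e isT ltac:(right; lia) ltac:(lia).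
  have := @col_dim_even_near1 r 4 _ _ C3 e isT ltac:(right; lia) ltac:(lia).
  by lia.
case: (ltnP (2 * width c3).+1 (width c2)) => q2a.
  have := @col_dim_even_ge r 2 (2 * width c3).+1 _ _ C2 e isT ltac:(lia) ltac:(lia).
  by nia.
have [q2E | q2b] : (width c2 = (2 * width c3).+1 \/ width c2 < (2 * width c3).+1)%N by lia.
  by have := @col_dim_even_ge r 6 3 _ _ C3 e isT ltac:(lia) ltac:(lia); lia.
have [q2E | q2E] : (width c2 = (width c3).+1 \/ (width c3).+1 < width c2)%N by lia.
  by have := @col_dim_even_ge r 4 3 _ _ C3 e isT ltac:(lia) ltac:(lia); lia.
have := @col_dim_odd_ge r 3 (2 * width c3 + 1 - width c2) _ _ C2 e isT ltac:(lia) ltac:(lia).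
have [w wE] : exists w, (width c2 = width c3 + w.+2)%N.
  by exists (width c2 - width c3 - 2)%N; lia.
have [b bE] : exists b, (width c3 = b + w.+2)%N.
  by exists (width c3 - w - 2)%N; lia.
rewrite (_ : (2 * width c3 + 1 - width c2 = b.+1)%N); last by lia.
by nia.
Qed.

(** All widths equal [r / 3], so each column dimension is 0 or at least [2 q - 4], and the three
    cannot all vanish. *)
Lemma equal_widths_bound (c : config) :
  is_config c -> (48 <= rank c)%N -> 4 <= config_dim c ->
  (rank c = 3 * width (column1 c))%N ->
  (rank c)%:Z < 3 * config_dim c + 36.
Proof.
case: c => r eps c1 c2 c3; case=> /= e /and3P[q30 q32 q21] rE [C1 C2 C3].
rewrite /config_dim /col_dim1 /col_dim2 /col_dim3 /= => r48 Dpos rq1.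
have := @col_dim_odd_mult r 3 _ _ C1 e isT ltac:(lia) ltac:(lia).
have := @col_dim_odd_mult r 3 _ _ C2 e isT ltac:(lia) ltac:(lia).
have := @col_dim_odd_mult r 3 _ _ C3 e isT ltac:(lia) ltac:(lia).
move=> /= [[_ _ D3]|D3|D3] [[_ _ D2]|D2|D2] [[_ _ D1]|D1|D1]; lia.
Qed.

Lemma odd_rank_bound_lt (c : config) :
  is_config c -> (48 <= rank c)%N -> 4 <= config_dim c -> odd (rank c) ->
  (2 * width (column1 c) < rank c)%N ->
  (rank c)%:Z < 3 * config_dim c + 36.
Proof.
move=> cP r48 Dpos oddr q1r.
have [eq1 | ne1] := eqVneq (rank c) (3 * width (column1 c))%N.
  exact: equal_widths_bound.
case: c cP r48 Dpos oddr q1r ne1 => r eps c1 c2 c3.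
case=> /= e /and3P[q30 q32 q21] rE [C1 C2 C3].
rewrite /config_dim /col_dim1 /col_dim2 /col_dim3 /= => r48 Dpos oddr q1r ne1.
have D1 := col_dim_odd_rank_ge0 C1 e ltac:(lia) oddr.
have D2 := col_dim_odd_rank_ge0 C2 e ltac:(lia) oddr.
have D3 := col_dim_odd_rank_ge0 C3 e ltac:(lia) oddr.
have [b1 | b2] : (width c2 + width c3 = width c1 + 1 \/ width c1 + 1 < width c2 + width c3)%N
  by lia.
  have [{}D1 | {}D1] := @col_dim_even_near1 r 2 _ _ C1 e isT ltac:(right; lia) ltac:(lia);
    last by lia.
  have [q31 | q31] : (width c3 = 1 \/ 2 <= width c3)%N by lia.
    have := col_dim_width1 C3 e q31.
    have := @col_dim_even_near1 r 2 _ _ C2 e isT ltac:(right; lia) ltac:(lia).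
    by lia.
  have [q23 | q23] : (width c2 = width c3 \/ width c3 < width c2)%N by lia.
    have := @col_dim_even_near1 r 4 _ _ C2 e isT ltac:(left; lia) ltac:(lia).
    have := @col_dim_even_near1 r 4 _ _ C3 e isT ltac:(left; lia) ltac:(lia).
    by lia.
  have [q2E | q2ne] := eqVneq (width c2).+1 (2 * width c3)%N.
    (* Here [r = 6 q3 - 3 = 5 q3 + (q3 - 3)]. *)
    by have := @col_dim_odd_ge r 5 (width c3 - 3) _ _ C3 e isT ltac:(lia) ltac:(lia); nia.
  case: (ltnP (width c2) (2 * width c3)) => q2a; last first.
    have := @col_dim_even_ge r 2 (2 * width c3 - 1) _ _ C2 e isT ltac:(lia) ltac:(lia).
    have [u uE] : exists u, (width c2 = 2 * width c3 + u)%N.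
      by exists (width c2 - 2 * width c3)%N; lia.
    have [b bE] : exists b, (width c3 = b + 2)%N by exists (width c3 - 2)%N; lia.
    rewrite (_ : (2 * width c3 - 1 = 2 * b + 3)%N); last by lia.
    by nia.
  have := @col_dim_odd_ge r 3 (2 * width c3 - 1 - width c2) _ _ C2 e isT ltac:(lia) ltac:(lia).
  have [w wE] : exists w, (width c2 = width c3 + w.+1)%N.
    by exists (width c2 - width c3 - 1)%N; lia.
  have [b bE] : exists b, (width c3 = b + w + 3)%N.
    by exists (width c3 - w - 3)%N; lia.
  rewrite (_ : (2 * width c3 - 1 - width c2 = b.+1)%N); last by lia.
  by nia.
have := @col_dim_even_ge r 2 (r - 2 * width c1) _ _ C1 e isT ltac:(lia) ltac:(lia).
have [b bE] : exists b, (r - 2 * width c1 = b + 2)%N.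
  by exists (r - 2 * width c1 - 2)%N; lia.
have [h hE] : exists h, (width c1 = b + 3 + h)%N.
  by exists (width c1 - b - 3)%N; lia.
rewrite bE.
by nia.
Qed.

(** Columns 2 and 3 may now contribute [- q2] and [- q3]. With [q1 = q2 + q3 + 2 (t + 1)] the first
    column outweighs them if [t > 0]; if [t = 0], a negative column has a width dividing [r / 2],
    which limits the sizes. *)
Lemma even_rank_bound_gt (c : config) :
  is_config c -> (48 <= rank c)%N -> 4 <= config_dim c -> ~~ odd (rank c) ->
  (rank c < 2 * width (column1 c))%N ->
  (rank c)%:Z < 3 * config_dim c + 36.
Proof.
case: c => r eps c1 c2 c3; case=> /= e /and3P[q30 q32 q21] rE [C1 C2 C3].
rewrite /config_dim /col_dim1 /col_dim2 /col_dim3 /= => r48 Dpos evr q1r.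
have D2 := col_dim_ge C2 e ltac:(lia).
have D3 := col_dim_ge C3 e ltac:(lia).
have := @col_dim_odd_ge r 1 (width c2 + width c3) _ _ C1 e isT ltac:(lia) ltac:(lia).
have [t tE] : exists t, (width c1 = width c2 + width c3 + 2 * t.+1)%N.
  by exists ((width c1 - (width c2 + width c3))./2).-1; lia.
case: t tE => [|t] tE D1; last by nia.
have {}D1 : (width c2)%:Z + (width c3)%:Z <= col_dim r eps c1 by lia.
case: D2 => [D2 | [D2 [a aE]]].
  case: D3 => [D3 | [D3 [a aE]]]; first by lia.
  have : (3 <= a)%N.
    by case: a aE => [|[|[|a]]] // aE; lia.
  by nia.
have [a2 | a2] : a = 2%N \/ a <> 2%N by lia.
  rewrite {}a2 in aE.
  have := @col_dim_even_ge r 4 4 _ _ C3 e isT ltac:(lia) ltac:(lia).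
  by lia.
by case: a aE a2 => [|[|[|a]]] // aE; nia.
Qed.

(** Since [r < 2 (q2 + q3) <= 4 q2], only the third column can be negative. In the parameters [b]
    and [h], [r = 3 b + 2 h + 8] while [D1 >= (b + 1) (h + 1)]. *)
Lemma even_rank_bound_lt (c : config) :
  is_config c -> (48 <= rank c)%N -> 4 <= config_dim c -> ~~ odd (rank c) ->
  (2 * width (column1 c) < rank c)%N ->
  (rank c)%:Z < 3 * config_dim c + 36.
Proof.
move=> cP r48 Dpos evr q1r.
have [eq1 | ne1] := eqVneq (rank c) (3 * width (column1 c))%N.
  exact: equal_widths_bound.
case: c cP r48 Dpos evr q1r ne1 => r eps c1 c2 c3.
case=> /= e /and3P[q30 q32 q21] rE [C1 C2 C3].
rewrite /config_dim /col_dim1 /col_dim2 /col_dim3 /= => r48 Dpos evr q1r ne1.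
have D2 : 0 <= col_dim r eps c2.
  by have [//|[_ [[|[|a]] aE]]] := col_dim_ge C2 e ltac:(lia); nia.
have D3 := col_dim_ge C3 e ltac:(lia).
have := @col_dim_even_ge r 2 (r - 2 * width c1) _ _ C1 e isT ltac:(lia) ltac:(lia).
have [b bE] : exists b, (r - 2 * width c1 = b + 2)%N.
  by exists (r - 2 * width c1 - 2)%N; lia.
have [h hE] : exists h, (width c1 = b + 3 + h)%N.
  by exists (width c1 - b - 3)%N; lia.
rewrite bE => D1.
case: D3 => [D3 | [D3 [a aE]]]; first by nia.
case: b h bE hE D1 => [|b] [|h] bE hE D1.
- by lia.
- have [a2 | a3] : (a = 2 \/ 3 <= a)%N by case: a aE => [|[|[|a]]]; lia.
    (* Now [r = 4 q3] and [q2 = q3 + 1], so [r = 3 q2 + (q2 - 4)]. *)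
    rewrite {}a2 in aE.
    by have := @col_dim_odd_ge r 3 (width c2 - 4) _ _ C2 e isT ltac:(lia) ltac:(lia); nia.
  by nia.
- by case: a aE => [|[|a]]; nia.
- by have : (4 * width c3 <= r)%N; [case: a aE => [|[|a]]; nia | nia].
Qed.

(** * Rank equal to twice the first width *)

Lemma half_quarter_quarter_bound (c : config) :
  is_config c -> (48 <= rank c)%N -> 4 <= config_dim c ->
  (rank c = 2 * width (column1 c))%N -> width (column2 c) = width (column3 c) ->
  (rank c)%:Z < 3 * config_dim c + 36.
Proof.
case: c => r eps c1 c2 c3; case=> /= e /and3P[q30 q32 q21] rE [C1 C2 C3].
rewrite /config_dim /col_dim1 /col_dim2 /col_dim3 /= => r48 Dpos rq1 q23.
have := @col_dim_even_mult r 2 _ _ C1 e isT ltac:(lia) ltac:(lia).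
have := @col_dim_even_mult r 4 _ _ C2 e isT ltac:(lia) ltac:(lia).
have := @col_dim_even_mult r 4 _ _ C3 e isT ltac:(lia) ltac:(lia).
(* Each combination gives a total below 4 or above [(r - 36) / 3]; for instance [- 2 q - q] plus a
   value in [[3 q - 4, 3 q]] is at most 0. *)
move=> /= [[_ _ D3]|D3|D3|[D3 _]] [[_ _ D2]|D2|D2|[D2 _]] [[_ _ D1]|D1|D1|[D1 _]]; lia.
Qed.

(** The total [- 3 q3 + 0 + (5 q3 - 12)] equals [(r - 36) / 3]. The closest competitor,
    [- 3 q3 + (6 q3 - 11) - q3], already exceeds it by 1. *)
Lemma half_third_sixth_bound (c : config) :
  is_config c -> (48 <= rank c)%N -> 4 <= config_dim c ->
  (rank c = 2 * width (column1 c))%N -> width (column2 c) = (2 * width (column3 c))%N ->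
  let q3 := (width (column3 c))%:Z in
  (rank c)%:Z < 3 * config_dim c + 36 \/
  [/\ [/\ col_dim1 c = - (3 * q3), col_dim2 c = 0 & col_dim3 c = 5 * q3 - 12],
      below 2 (column1 c) = 0%N /\ above 2 (column1 c) = 0%N,
      below 3 (column2 c) = 0%N /\ above 3 (column2 c) = 0%N
    & exists k, [/\ k = 2%N \/ k = 3%N,
        below 6 (column3 c) = k, above 6 (column3 c) = k,
        nbelow 6 (column3 c) = k & nabove 6 (column3 c) = k]].
Proof.
case: c => r eps c1 c2 c3; case=> /= e /and3P[q30 q32 q21] rE [C1 C2 C3].
rewrite /config_dim /col_dim1 /col_dim2 /col_dim3 /= => r48 Dpos rq1 q23.
have := @col_dim_even_mult r 2 _ _ C1 e isT ltac:(lia) ltac:(lia).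
have := @col_dim_odd_mult r 3 _ _ C2 e isT ltac:(lia) ltac:(lia).
have := @col_dim_even_mult r 6 _ _ C3 e isT ltac:(lia) ltac:(lia).
move=> /= [[_ _ D3]|D3|D3|[D3 D3E]] [[M2 P2 D2]|D2|D2] [[M1 P1 D1]|D1|D1|[D1 _]];
  try by left; lia.
have [D3eq | D3ne] := eqVneq (col_dim r eps c3) (5 * (width c3)%:Z - 12); last by left; lia.
have [D1eq | D1eq] : col_dim r eps c1 = - (3 * (width c3)%:Z)
                     \/ col_dim r eps c1 = 3 * (width c3)%:Z by lia.
  by right; split=> //; exact: D3E D3eq.
by left; lia.
Qed.

(** For [q2 >= 2 q3 + 3] the bound on the second column suffices. At [2 q3 + 1] the gaps near [3 q2]
    and [6 q3] are used, at [2 q3 + 2] the remainder 4 of [r] over [6 q3]. *)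
Lemma wide_second_bound (c : config) :
  is_config c -> (48 <= rank c)%N -> 4 <= config_dim c ->
  (rank c = 2 * width (column1 c))%N -> (2 * width (column3 c) < width (column2 c))%N ->
  (rank c)%:Z < 3 * config_dim c + 36.
Proof.
case: c => r eps c1 c2 c3; case=> /= e /and3P[q30 q32 q21] rE [C1 C2 C3].
rewrite /config_dim /col_dim1 /col_dim2 /col_dim3 /= => r48 Dpos rq1 q23.
have D1 := @col_dim_even_mult r 2 _ _ C1 e isT ltac:(lia) ltac:(lia).
have {}D1 : - (width c1)%:Z = col_dim r eps c1 \/ (width c1)%:Z <= col_dim r eps c1.
  by case: D1 => /= [[_ _ D1]|D1|D1|[D1 _]]; lia.
have [q31 | q32'] : (width c3 = 1 \/ 2 <= width c3)%N by lia.
  have := col_dim_width1 C3 e q31.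
  have /= := @col_dim_even_near2 r 2 _ _ C2 e isT ltac:(right; lia) ltac:(lia).
  by lia.
have D2 := @col_dim_even_ge r 2 (2 * width c3) _ _ C2 e isT ltac:(lia) ltac:(lia).
have D3 : - (width c3)%:Z <= col_dim r eps c3 by case: (col_dim_ge C3 e ltac:(lia)); lia.
have [g1 | [g2 | g3]] : (width c2 = 2 * width c3 + 1 \/ width c2 = 2 * width c3 + 2
                         \/ 2 * width c3 + 3 <= width c2)%N by lia.
- have /= := @col_dim_odd_near1 r 3 _ _ C2 e isT ltac:(left; lia) ltac:(lia).
  have /= := @col_dim_even_near2 r 6 _ _ C3 e isT ltac:(right; lia) ltac:(lia).
  by lia.
- have := @col_dim_even_ge r 6 4 _ _ C3 e isT ltac:(lia) ltac:(lia).
  by lia.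
have [h hE] : exists h, (width c2 = 2 * width c3 + h + 3)%N.
  by exists (width c2 - 2 * width c3 - 3)%N; lia.
have [p pE] : exists p, (width c3 = p + 2)%N by exists (width c3 - 2)%N; lia.
by nia.
Qed.

(** The parameters [m] and [p] place [q2] between [q3] and [2 q3], with
    [r = 3 q2 + p + 1 = 4 q3 + 2 (m + 1)]. At the ends [m = 0] and [p = 0] the gaps are needed;
    inside, the lower bounds suffice. *)
Lemma narrow_second_bound (c : config) :
  is_config c -> (48 <= rank c)%N -> 4 <= config_dim c ->
  (rank c = 2 * width (column1 c))%N ->
  (width (column3 c) < width (column2 c) < 2 * width (column3 c))%N ->
  (rank c)%:Z < 3 * config_dim c + 36.
Proof.
case: c => r eps c1 c2 c3; case=> /= e /and3P[q30 q32 q21] rE [C1 C2 C3].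
rewrite /config_dim /col_dim1 /col_dim2 /col_dim3 /= => r48 Dpos rq1 /andP[q23 q23'].
have D1 := @col_dim_even_mult r 2 _ _ C1 e isT ltac:(lia) ltac:(lia).
have {}D1 : - (width c1)%:Z = col_dim r eps c1 \/ (width c1)%:Z <= col_dim r eps c1.
  by case: D1 => /= [[_ _ D1]|D1|D1|[D1 _]]; lia.
have [m mE] : exists m, (width c2 = width c3 + m.+1)%N.
  by exists (width c2 - width c3 - 1)%N; lia.
have [p pE] : exists p, (width c3 = m + p + 2)%N by exists (width c3 - m - 2)%N; lia.
have D2 := @col_dim_odd_ge r 3 p.+1 _ _ C2 e isT ltac:(lia) ltac:(lia).
have [m0 | m1] : m = 0%N \/ (0 < m)%N by lia.
  have /= := @col_dim_even_near2 r 4 _ _ C2 e isT ltac:(left; lia) ltac:(lia).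
  have /= := @col_dim_even_near2 r 4 _ _ C3 e isT ltac:(right; lia) ltac:(lia).
  by lia.
have [p0 | p1] : p = 0%N \/ (0 < p)%N by lia.
  have /= := @col_dim_odd_near1 r 3 _ _ C2 e isT ltac:(right; lia) ltac:(lia).
  have /= := @col_dim_even_near2 r 6 _ _ C3 e isT ltac:(left; lia) ltac:(lia).
  by lia.
case: (leqP (2 * m.+1) (width c3)) => m2.
  have D3 := @col_dim_even_ge r 4 (2 * m.+1) _ _ C3 e isT ltac:(lia) ltac:(lia).
  have [u uE] : exists u, (p = m + u)%N by exists (p - m)%N; lia.
  by nia.
have D3 := @col_dim_odd_ge r 5 (2 * m.+1 - width c3) _ _ C3 e isT ltac:(lia) ltac:(lia).
have [u uE] : exists u, (m = p + u.+1)%N by exists (m - p - 1)%N; lia.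
rewrite (_ : (2 * m.+1 - width c3 = u.+1)%N) in D3; last by lia.
by nia.
Qed.

Lemma large_rank_bound (c : config) :
  is_config c -> (48 <= rank c)%N -> 4 <= config_dim c ->
  (rank c)%:Z < 3 * config_dim c + 36 \/
  (rank c)%:Z = 3 * config_dim c + 36 /\ exists2 k, k = 2%N \/ k = 3%N & extremal k c.
Proof.
move=> cP r48 Dpos; have [e /and3P[q30 q32 q21] rE [C1 C2 C3]] := cP.
have [q1E | q1ne] := eqVneq (rank c) (2 * width (column1 c))%N; last first.
  left; case: (ltngtP (rank c) (2 * width (column1 c))%N) => [gt1 | lt1 | eq1].
  - by case: (boolP (odd (rank c))) => o;
      [exact: odd_rank_bound_gt | exact: even_rank_bound_gt].
  - by case: (boolP (odd (rank c))) => o;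
      [exact: odd_rank_bound_lt | exact: even_rank_bound_lt].
  - by rewrite eq1 eqxx in q1ne.
have [q23 | q23] := eqVneq (width (column2 c)) (width (column3 c)).
  by left; exact: half_quarter_quarter_bound.
case: (ltngtP (width (column2 c)) (2 * width (column3 c))%N) => [lt2 | gt2 | eq2].
- by left; apply: narrow_second_bound => //; lia.
- by left; exact: wide_second_bound.
have [?|[[D1 D2 D3] [M1 P1] [M2 P2] [k [k23 M3 P3 x3 y3]]]] :=
  half_third_sixth_bound cP r48 Dpos q1E eq2; first by left.
right; split; first by rewrite /config_dim D1 D2 D3; lia.
exists k => //.
have [x1 y1] := (nbelow_le 2 (column1 c), nabove_le 2 (column1 c)).
have [x2 y2] := (nbelow_le 3 (column2 c), nabove_le 3 (column2 c)).
rewrite M1 leqn0 in x1; rewrite P1 leqn0 in y1; rewrite M2 leqn0 in x2; rewrite P2 leqn0 in y2.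
move: x1 y1 x2 y2 => /eqP x1 /eqP y1 /eqP x2 /eqP y2.
split; first by split; lia.
- split.
  (* Without deviations the entry [nabove] is 0 and is filtered out. *)
  + have := @part_sizes_near _ 1 _ C1; rewrite M1 P1 x1 y1 => /(_ erefl erefl).
    by rewrite /= subn0 (_ : 0 < width (column1 c))%N //; lia.
  + have := @part_sizes_near _ 2 _ C2; rewrite M2 P2 x2 y2 => /(_ erefl erefl).
    by rewrite /= subn0 (_ : 0 < width (column2 c))%N //; lia.
  + have := @part_sizes_near _ 5 _ C3; rewrite M3 P3 x3 y3 => /(_ erefl erefl).
    by rewrite (all_filterP _) // all_cat all_nseq /=; lia.
- by split; lia.
Qed.

(** * Extremal configurations *)

Lemma extremal_dim (d k : nat) (c : config) :
  rank c = (6 * d + 36)%N -> extremal k c -> config_dim c = (2 * d)%:Z.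
Proof. by move=> rE [_ _ [D1 D2 D3]]; rewrite /config_dim D1 D2 D3 rE; lia. Qed.

Lemma alt_sum_parts (k : ptype) (c : column) (s : seq nat) :
  [seq p.1 | p <- parts c & p.2 == k] = s -> sorted geq s ->
  alt_sum (parts_of_type k c) = alt_sum s.
Proof.
by move=> <- ss; rewrite /parts_of_type sorted_sort // => a b e ba ad; apply: leq_trans ad ba.
Qed.

Lemma alt_sum_nil : alt_sum [::] = 0.
Proof. by rewrite /alt_sum big_ord0. Qed.

Lemma col_dim_types (r : nat) (eps : int) (c : column) (s1 s2 : seq nat) :
  [seq p.1 | p <- parts c & p.2 == TypeE] = s1 -> sorted geq s1 ->
  [seq p.1 | p <- parts c & p.2 == TypeF] = s2 -> sorted geq s2 ->
  col_dim r eps c = (r * width c)%:Z - \sum_(x <- part_sizes c) (x ^ 2)%:Z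
                    - eps * ((width c)%:Z - alt_sum s1 - alt_sum s2).
Proof.
by move=> e1 o1 e2 o2; rewrite /col_dim /lin_corr (alt_sum_parts e1 o1) (alt_sum_parts e2 o2).
Qed.

Lemma example_config (q : nat) (eps : int) (t1 t3 : ptype) (k : nat) :
  eps = 1 \/ eps = -1 -> t1 <> TypeM -> t3 <> TypeM -> (0 < k < q)%N ->
  is_config (example (6 * q) eps t1 t3 k).
Proof.
move=> e t1M t3M /andP[k0 kq]; rewrite /example.
have -> : (6 * q %/ 2 = 3 * q)%N by lia.
have -> : (6 * q %/ 3 = 2 * q)%N by lia.
have -> : (6 * q %/ 6 = q)%N by lia.
split=> //=; [lia | lia | split; split=> /=; try lia].
- by move=> x; rewrite !xpair_eqE !andbF; case: t1 t1M => //; rewrite !andbF.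
- by move=> x; rewrite !xpair_eqE !andbF.
- by move=> x; rewrite !xpair_eqE !andbF; case: t3 t3M => //; rewrite !andbF.
Qed.

Lemma example_extremal (q : nat) (eps : int) (t1 t3 : ptype) (k : nat) :
  (6 <= q)%N ->
  [\/ [/\ eps = -1, t1 = TypeF, t3 = TypeE & k = 2%N],
      [/\ eps = 1, t1 = TypeE, t3 = TypeF & k = 2%N],
      [/\ eps = -1, t1 = TypeF, t3 = TypeF & k = 3%N]
    | [/\ eps = 1, t1 = TypeE, t3 = TypeE & k = 3%N]] ->
  extremal k (example (6 * q) eps t1 t3 k).
Proof.
move=> q6 cases; rewrite /extremal /col_dim1 /col_dim2 /col_dim3 /=.
have q1E : (6 * q %/ 2 = 3 * q)%N by lia.
have q2E : (6 * q %/ 3 = 2 * q)%N by lia.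
have q3E : (6 * q %/ 6 = q)%N by lia.
rewrite q1E q2E q3E; split; [by split | by split; apply: perm_refl |].
(* As [k <= 3], a triple successor lets [q - k] compute. *)
case: q q6 {q1E q2E q3E} => [|[|[|q]]] // q6.
by case: cases => -[-> -> -> ->]; split;
  (erewrite col_dim_types; [| reflexivity | | reflexivity |]);
  rewrite /part_sizes /= ?subSS ?subn0 ?big_cons ?big_nil ?alt_sum_cons ?alt_sum_nil /geq /=; lia.
Qed.

Theorem theorem2p18 (d : nat) (d_ge2 : (2 <= d)%N) (d_even : ~~ odd d) :
  [/\ (* the bound on the rank *)
      forall c : config, is_config c -> config_dim c = (2 * d)%:Z ->
        (rank c <= 6 * d + 36)%N,
      (* the configurations that achieve it *)
      forall c : config, is_config c ->
        (config_dim c = (2 * d)%:Z /\ rank c = (6 * d + 36)%N) <->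
        (rank c = (6 * d + 36)%N /\ (extremal 2 c \/ extremal 3 c)),
      (* for both signs and both third partitions, such type choices exist *)
      forall (eps : int) (k : nat), eps = 1 \/ eps = -1 -> k = 2%N \/ k = 3%N ->
        exists c : config,
          [/\ is_config c, sgn c = eps, rank c = (6 * d + 36)%N & extremal k c]
    & (* examples *)
      let r := (6 * d + 36)%N in
      let good k c := is_config c /\ extremal k c in
      [/\ good 2%N (example r (-1) TypeF TypeE 2),
          good 2%N (example r 1 TypeE TypeF 2),
          good 3%N (example r (-1) TypeF TypeF 3)
        & good 3%N (example r 1 TypeE TypeE 3)]].
Proof.
(* So [q3 = d + 6], and the divisions of the rank by 2, 3 and 6 are exact. *)
have rE : (6 * d + 36 = 6 * (d + 6))%N by lia.
have examples : let r := (6 * d + 36)%N in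
    let good k c := is_config c /\ extremal k c in
    [/\ good 2%N (example r (-1) TypeF TypeE 2),
        good 2%N (example r 1 TypeE TypeF 2),
        good 3%N (example r (-1) TypeF TypeF 3)
      & good 3%N (example r 1 TypeE TypeE 3)].
  rewrite /= rE; split; (split; first by apply: example_config => //; [auto | lia]);
    (apply: example_extremal; first by lia).
  - by apply: Or41. - by apply: Or42. - by apply: Or43. - by apply: Or44.
split=> //.
- move=> c cP D; case: (ltnP (rank c) 48) => r48; first by lia.
  by case: (large_rank_bound cP r48); lia.
- move=> c cP; split=> [[D r] | [r ext]]; split=> //.
    have [|[_ [k [->|->] ext]]] := large_rank_bound cP ltac:(lia) ltac:(lia);
      [by lia | by left | by right].
  by case: ext => ext; exact: extremal_dim r ext.
- have [E1 E2 E3 E4] := examples.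
  move=> eps k [->|->] [->|->].
  + by case: E2 => ? ?; exists (example (6 * d + 36) 1 TypeE TypeF 2).
  + by case: E4 => ? ?; exists (example (6 * d + 36) 1 TypeE TypeE 3).
  + by case: E1 => ? ?; exists (example (6 * d + 36) (-1) TypeF TypeE 2).
  + by case: E3 => ? ?; exists (example (6 * d + 36) (-1) TypeF TypeF 3).
Qed.
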